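(* Let $G$ be a partial cube of VC-dimension at most $2$. If $H=SK_n$ with $n\ge 4$ is a convex subgraph of $G$ and $H$ is not included in a larger full subdivision of $G$, then $H$ is a gated subgraph of $G$.
   Context: All graphs are finite, connected and simple. An induced subgraph $H$ of $G$ is isometric if distances in $H$ equal those in $G$. A partial cube is a graph isometrically embeddable in a hypercube $Q_m$ (vertices: subsets of $\{1,\dots,m\}$, adjacent iff their symmetric difference has size 1); it is identified with its image, hence with a set family. Its VC-dimension is the maximum size of a set $X$ with $\{X\cap S: S\in V(G)\}=2^X$. $SK_n$ is the graph obtained from the complete graph $K_n$ by subdividing each edge once; a full subdivision of $G$ is an isometric subgraph of $G$ isomorphic to some $SK_r$. An induced subgraph is convex if it contains all shortest paths of $G$ between its vertices. An induced subgraph $H$ is gated if for every vertex $x$ outside $H$ there is a vertex $x'$ of $H$ such that each vertex $y$ of $H$ is joined to $x$ by a shortest path of $G$ passing through $x'$. *)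

(* Defs.v *)
From mathcomp Require Import all_boot.

Set Implicit Arguments.
Unset Strict Implicit.
Unset Printing Implicit Defensive.

Record sgraph := SGraph {
  vertex :> finType;
  adj : rel vertex;
  adj_sym : symmetric adj;
  adj_irr : irreflexive adj }.

Definition connected (G : sgraph) : Prop := forall x y : G, connect (@adj G) x y.

Definition is_walk (G : sgraph) (x y : G) (p : seq G) : bool :=
  path (@adj G) x p && (last x p == y).

(* The least length of a walk from x to y. When x and y are connected this
   length is less than #|G|; otherwise the junk value #|G| is returned. *)
Definition dist (G : sgraph) (x y : G) : nat :=
  find (fun k => [exists p : k.-tuple G, is_walk x y p]) (iota 0 #|G|).

(* p lists the vertices of the path after its origin x. *)
Definition shortest_path (G : sgraph) (x y : G) (p : seq G) : bool :=
  is_walk x y p && (size p == dist x y).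

Definition isometric_embedding (G G' : sgraph) (f : G -> G') : Prop :=
  forall x y : G, dist (f x) (f y) = dist x y.

Definition isomorphic (G G' : sgraph) : Prop :=
  exists2 f : G -> G', bijective f & forall x y, adj (f x) (f y) = adj x y.

Section Induced.
Variables (G : sgraph) (H : {set G}).

Definition induced_adj : rel {x : G | x \in H} :=
  fun u v => adj (val u) (val v).

Lemma induced_sym : symmetric induced_adj.
Proof. by move=> u v; apply: adj_sym. Qed.

Lemma induced_irr : irreflexive induced_adj.
Proof. by move=> u; apply: adj_irr. Qed.

Definition induced : sgraph := SGraph induced_sym induced_irr.

(* Connectedness is required explicitly because dist is junk on unconnected
   pairs of vertices. *)
Definition isometric_subgraph : Prop :=
  connected induced /\
  @isometric_embedding induced G (fun u => val u).

Definition convex_subgraph : Prop :=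
  forall (x y : G) (p : seq G), x \in H -> y \in H ->
    shortest_path x y p -> {subset p <= H}.

Definition gated_subgraph : Prop :=
  forall x : G, x \notin H ->
    exists2 x' : G, x' \in H &
      forall y : G, y \in H ->
        exists2 p : seq G, shortest_path x y p & x' \in x :: p.

End Induced.

Section Hypercube.
Variable m : nat.

Definition hypercube_adj : rel {set 'I_m} :=
  fun A B => #|(A :\: B) :|: (B :\: A)| == 1.

Lemma hypercube_sym : symmetric hypercube_adj.
Proof. by move=> A B; rewrite /hypercube_adj setUC. Qed.

Lemma hypercube_irr : irreflexive hypercube_adj.
Proof. by move=> A; rewrite /hypercube_adj setDv setU0 cards0. Qed.

Definition hypercube : sgraph := SGraph hypercube_sym hypercube_irr.

End Hypercube.

Definition shattered (T : finType) (F : {set {set T}}) (X : {set T}) : bool :=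
  [set X :&: S | S in F] == powerset X.

Definition VCdim (T : finType) (F : {set {set T}}) : nat :=
  \max_(X : {set T} | shattered F X) #|X|.

Section Complete.
Variable n : nat.

Definition complete_adj : rel 'I_n := fun i j => i != j.

Lemma complete_sym : symmetric complete_adj.
Proof. by move=> i j; apply: (congr1 negb); apply: eq_sym. Qed.

Lemma complete_irr : irreflexive complete_adj.
Proof. by move=> i; rewrite /complete_adj eqxx. Qed.

Definition complete : sgraph := SGraph complete_sym complete_irr.

End Complete.

Section Subdivision.
Variable G : sgraph.

Definition edges : {set {set G}} :=
  [set A | [exists x, exists y, adj x y && (A == [set x; y])]].

(* inl x is an original vertex, inr A the vertex subdividing the edge A. *)
Definition subdivision_adj : rel (G + {A : {set G} | A \in edges})%type :=
  fun u v => match u, v with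
             | inl x, inr A => x \in val A
             | inr A, inl x => x \in val A
             | _, _ => false
             end.

Lemma subdivision_sym : symmetric subdivision_adj.
Proof. by case=> [x|A] [y|B]. Qed.

Lemma subdivision_irr : irreflexive subdivision_adj.
Proof. by case. Qed.

Definition subdivision : sgraph := SGraph subdivision_sym subdivision_irr.

End Subdivision.

Definition SK (n : nat) : sgraph := subdivision (complete n).

Definition full_subdivision (G : sgraph) (H : {set G}) : Prop :=
  isometric_subgraph H /\ exists r : nat, isomorphic (induced H) (SK r).

(* Main.v *)
Require Import Defs.
From mathcomp Require Import all_boot.

Set Implicit Arguments.
Unset Strict Implicit.
Unset Printing Implicit Defensive.

(** Translate the hypercube so that [H] becomes the family of all one- and
two-element subsets of a set [N] of [n] coordinates. Since [n >= 4], all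
patterns on three elements of [N] but the full one occur in [H], so VC-dimension
2 forces [#|S :&: N| <= 2] for every vertex [S]; if [S :&: N] is nonempty it is
a vertex of [H], and it is the gate of [S].

It remains to exclude vertices disjoint from [N]. Let [B] be one of least size;
it is nonempty because [H] is convex. For [i] in [N], the first and last steps of
geodesics between [B] and [[set i]] show that [i |: B], [[set i; b_i]] and
[i |: (B :\ x_i)] are vertices for some [b_i, x_i] in [B]. No vertex contains
two elements [i, j] of [N] and one element [b] of [B], as [[set i; j; b]] would
be shattered. Hence, if [P] is a proper subset of [B] and [i |: P] is a vertex, no
geodesic can join [[set j; b_j]] to it when [b_j \in P], and so [b_j \notin P]
for [j != i]. If [#|B| >= 2] this applies to [P = [set b_i]] and
[P = B :\ x_i], and three elements of [N] yield a contradiction. So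
[B = [set b]], and adding [b] to [N] gives a full subdivision larger than [H]. *)

(** * Graph distances *)

Section Distance.
Variable G : sgraph.
Implicit Types (x y z : G) (p q : seq G).

Lemma dist_le_walk x y p : is_walk x y p -> dist x y <= size p.
Proof.
move=> wp; rewrite /dist; set P := fun k => _.
(* For longer walks the bound holds because [find] never exceeds the length [#|G|] of the list it
   searches. *)
have [lt_pG|le_Gp] := ltnP (size p) #|G|; last first.
  by apply: leq_trans (find_size _ _) _; rewrite size_iota.
rewrite leqNgt; apply/negP => /(before_find 0).
by rewrite nth_iota // add0n => /existsP; apply; exists (in_tuple p).
Qed.

Lemma shortest_path_exists x y :
  connect (@adj G) x y -> exists p, shortest_path x y p.
Proof.
case/connectP=> p0 /shortenP[p pp up _] ->.
set z := last x p; rewrite /shortest_path.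
(* A duplicate-free path has fewer than [#|G|] edges, so the search defining [dist] succeeds. *)
have sz : size p < #|G| by have := card_uniqP up => /= <-; apply: max_card.
have: has (fun k => [exists q : k.-tuple G, is_walk x z q]) (iota 0 #|G|).
  apply/hasP; exists (size p); first by rewrite mem_iota.
  by apply/existsP; exists (in_tuple p); rewrite /is_walk pp eqxx.
move=> hs; have := nth_find 0 hs; rewrite nth_iota; last first.
  by move: hs; rewrite has_find size_iota.
rewrite add0n => /existsP[q wq]; exists q.
by rewrite wq size_tuple /dist eqxx.
Qed.

Lemma dist_triangle x y z : connected G -> dist x z <= dist x y + dist y z.
Proof.
move=> cG; have [p /andP[/andP[pp /eqP lp] /eqP <-]] := shortest_path_exists (cG x y).
have [q /andP[/andP[pq /eqP lq] /eqP <-]] := shortest_path_exists (cG y z).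
rewrite -size_cat; apply: dist_le_walk.
by rewrite /is_walk cat_path last_cat pp lp pq lq eqxx.
Qed.

Lemma distxx x : dist x x = 0.
Proof. by apply/eqP; rewrite -leqn0; apply: (@dist_le_walk x x [::]); rewrite /is_walk /= eqxx. Qed.

Lemma dist_eq0 x y : connected G -> (dist x y == 0) = (x == y).
Proof.
move=> cG; apply/eqP/eqP => [d0|->]; last exact: distxx.
have [[|z p] /andP[/andP[_ /eqP /= l]]] := shortest_path_exists (cG x y); first by [].
by rewrite d0.
Qed.

Lemma dist_eq1 x y : connected G -> (dist x y == 1) = adj x y.
Proof.
move=> cG; apply/idP/idP => [/eqP d1|axy].
  have [[|z [|t p]] /andP[/andP[/= pp /eqP l]]] := shortest_path_exists (cG x y).
  - by rewrite d1.
  - by move: pp => /=; rewrite -l andbT.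
  - by rewrite d1.
rewrite eqn_leq (@dist_le_walk _ _ [:: y]) ?/is_walk /= ?axy ?eqxx //=.
rewrite lt0n dist_eq0 //; apply: contraTneq axy => ->; by rewrite adj_irr.
Qed.

Lemma dist_step x y : connected G -> x != y ->
  exists2 z, adj x z & dist x y = (dist z y).+1.
Proof.
move=> cG; rewrite -(dist_eq0 _ _ cG) => nz.
have [[|z p] /andP[/andP[/= pp l] /eqP sz]] := shortest_path_exists (cG x y).
  by rewrite -sz in nz.
case/andP: pp => axz pz; exists z => //.
apply/eqP; rewrite eqn_leq -{2}sz /= ltnS dist_le_walk ?/is_walk ?pz ?andbT //.
have d1 : dist x z = 1 by apply/eqP; rewrite dist_eq1.
by have := dist_triangle x z y cG; rewrite d1.
Qed.

Section Characterisation.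
Variable D : G -> G -> nat.
Hypothesis Dadj : forall x y z, adj x y -> D x z <= (D y z).+1.
Hypothesis Dxx : forall x, D x x = 0.
Hypothesis Dstep : forall x y, x != y ->
  exists2 z, adj x z & D x y = (D z y).+1.

Lemma walk_of_step x y : exists2 p, is_walk x y p & size p = D x y.
Proof.
move: {2}(D x y) (erefl (D x y)) => k; elim: k x => [|k IH] x Dk;
    (have [exy|/Dstep[z axz]] := eqVneq x y).
- by exists [::]; rewrite /is_walk //= exy eqxx.
- by rewrite Dk.
- by rewrite exy Dxx in Dk.
rewrite Dk => -[/esym Dz]; have [p /andP[pp lp] sp] := IH z (Dz).
by exists (z :: p); rewrite /is_walk /= ?axz ?pp ?sp ?Dz.
Qed.

Lemma connected_of_step : connected G.
Proof.
move=> x y; have [p /andP[pp /eqP lp] _] := walk_of_step x y.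
by apply/connectP; exists p.
Qed.

(** Following the decreasing steps gives a walk of length [D x y]; conversely, [D] drops by at most
    one along each edge of a walk. Used for hypercubes and for induced subgraphs. *)
Lemma dist_of_step x y : dist x y = D x y.
Proof.
apply/eqP; rewrite eqn_leq; apply/andP; split.
  by have [p wp <-] := walk_of_step x y; apply: dist_le_walk.
have [p /andP[/andP[pp /eqP <-] /eqP <-]] :=
  shortest_path_exists (connected_of_step x y).
elim: p x pp => [|z p IH] x /=; first by rewrite Dxx.
by case/andP=> axz /IH le_zp; apply: leq_trans (Dadj _ axz) _.
Qed.

End Characterisation.
End Distance.

(** * Symmetric differences and hypercube distances *)

Section SymmetricDifference.
Variable T : finType.
Implicit Types (A B C : {set T}) (t : T).

(** The same expression as in [hypercube_adj]. Membership is exclusive or, hence the group laws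
    below. *)
Definition symdiff A B := (A :\: B) :|: (B :\: A).

Lemma in_symdiff A B t : (t \in symdiff A B) = (t \in A) (+) (t \in B).
Proof. by rewrite !inE; case: (t \in A); case: (t \in B). Qed.

Lemma symdiffC A B : symdiff A B = symdiff B A.
Proof. by rewrite /symdiff setUC. Qed.

Lemma symdiffA A B C : symdiff A (symdiff B C) = symdiff (symdiff A B) C.
Proof. by apply/setP => t; rewrite !in_symdiff addbA. Qed.

Lemma symdiffxx A : symdiff A A = set0.
Proof. by apply/setP => t; rewrite in_symdiff addbb inE. Qed.

Lemma symdiff0 A : symdiff A set0 = A.
Proof. by apply/setP => t; rewrite in_symdiff inE addbF. Qed.

Lemma symdiffK A : involutive (symdiff A).
Proof. by move=> B; rewrite symdiffA symdiffxx symdiffC symdiff0. Qed.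

(** Translations preserve hypercube distances, which allows recentring. *)
Lemma symdiff_translate A B C :
  symdiff (symdiff A B) (symdiff A C) = symdiff B C.
Proof. by apply/setP => t; rewrite !in_symdiff; do 3!case: (t \in _). Qed.

Lemma card_symdiff_eq0 A B : (#|symdiff A B| == 0) = (A == B).
Proof.
rewrite cards_eq0; apply/eqP/eqP => [e|->]; last exact: symdiffxx.
by rewrite -(symdiffK A B) e symdiff0.
Qed.

Lemma card_symdiff1 A t :
  #|symdiff A [set t]| = if t \in A then #|A|.-1 else #|A|.+1.
Proof.
case: ifP => tA.
  have -> : symdiff A [set t] = A :\ t.
    by apply/setP => s; rewrite in_symdiff !inE; case: eqP => [->|_];
       rewrite ?tA ?addbF.
  by rewrite (cardsD1 t A) tA.
have -> : symdiff A [set t] = t |: A.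
  by apply/setP => s; rewrite in_symdiff !inE; case: eqP => [->|_];
     rewrite ?tA ?addbF.
by rewrite cardsU1 tA.
Qed.

End SymmetricDifference.

Lemma hypercube_dist m (A B : {set 'I_m}) :
  @dist (hypercube m) A B = #|symdiff A B|.
Proof.
apply: (@dist_of_step (hypercube m) (fun A B => #|symdiff A B|)) => {A B}.
- move=> A B C /= /cards1P[t]; rewrite -/(symdiff A B) => e.
  have -> : symdiff A C = symdiff (symdiff B C) [set t].
    by rewrite -e (symdiffC A B) symdiff_translate symdiffC.
  by rewrite card_symdiff1; case: ifP => // _; rewrite leqW // leq_pred.
- by move=> A; rewrite symdiffxx cards0.
move=> A B; rewrite -card_symdiff_eq0 cards_eq0 => /set0Pn[t tAB].
exists (symdiff A [set t]) => /=.
  by rewrite /hypercube_adj -/(symdiff _ _) symdiffK cards1.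
have -> : symdiff (symdiff A [set t]) B = symdiff (symdiff A B) [set t].
  by rewrite -!symdiffA (symdiffC B).
by rewrite card_symdiff1 tAB prednK // card_gt0; apply/set0Pn; exists t.
Qed.

(** * Traces of isometric families of VC-dimension two *)

(* Isometry of F in the hypercube, read off the first step of a geodesic
   from A to B. *)
Definition geodesically_closed (T : finType) (F : {set {set T}}) : Prop :=
  forall A B, A \in F -> B \in F -> A != B ->
    (exists t, [/\ t \in A, t \notin B & A :\ t \in F]) \/
    (exists t, [/\ t \notin A, t \in B & t |: A \in F]).

(** For distinct [i], [j], [b] this is shattering of [[set i; j; b]], in a form where the eight
    traces are exhibited one by one. *)
Definition realizes_patterns (T : finType) (F : {set {set T}}) (i j b : T) :=
  forall p q r : bool, exists2 A, A \in F &
    [/\ (i \in A) = p, (j \in A) = q & (b \in A) = r].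

Lemma VCdim2_not_realizes (T : finType) (F : {set {set T}}) (i j b : T) :
  VCdim F <= 2 -> i != j -> i != b -> j != b -> ~ realizes_patterns F i j b.
Proof.
move=> vcF ij ib jb all_patterns; pose X := [set i; j; b].
have shX : shattered F X.
  rewrite /shattered eqEsubset; apply/andP; split; apply/subsetP => Y.
    by case/imsetP=> A _ ->; rewrite inE subsetIl.
  rewrite inE => /subsetP YX.
  have [A AF [iA jA bA]] := all_patterns (i \in Y) (j \in Y) (b \in Y).
  apply/imsetP; exists A => //; apply/setP => s; rewrite [RHS]inE.
  have [sX|/negP sX] := boolP (s \in X); last by apply/negbTE/negP => /YX.
  by move: sX; rewrite !inE => /orP[/orP[]|] /eqP ->; rewrite ?iA ?jA ?bA.
have: #|X| <= 2.
  apply: leq_trans vcF.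
  exact: (@leq_bigmax_cond _ (shattered F) (fun X : {set T} => #|X|)).
by rewrite /X setUC cardsU1 cards2 ij !inE negb_or ![b == _]eq_sym ib jb.
Qed.

Section TraceOrExtension.
Variables (T : finType) (F : {set {set T}}) (N : {set T}).
Hypothesis Fgeo : geodesically_closed F.
Hypothesis not_shattered3 : forall i j b, i != j -> i != b -> j != b ->
  ~ realizes_patterns F i j b.
Hypothesis N4 : 4 <= #|N|.
Hypothesis FN : {in N &, forall i j, [set i; j] \in F}.
(** In the application this comes from convexity: the empty set would lie between two singletons. *)
Hypothesis F0 : set0 \notin F.

Lemma exists_avoiding (X : {set T}) :
  #|X| <= 3 -> exists2 k, k \in N & k \notin X.
Proof.
move=> X3; have /set0Pn[k] : N :\: X != set0.
  rewrite setD_eq0; apply: contraL N4 => /subset_leq_card le_NX.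
  by rewrite -ltnNge ltnS (leq_trans le_NX).
by rewrite inE => /andP[]; exists k.
Qed.

Lemma singleton_mem i : i \in N -> [set i] \in F.
Proof. by move=> iN; have := FN iN iN; rewrite setUid. Qed.

Lemma card_trace_le2 A : A \in F -> #|A :&: N| <= 2.
Proof.
move=> AF; rewrite leqNgt; apply/negP => /card_gt2P[i [j [k]]].
rewrite !inE => -[[/andP[iA iN] /andP[jA jN] /andP[kA kN]] [ij jk ki]].
(* The empty pattern cannot come from [set0]; a fourth element [l] of [N] provides it through
   [[set l]]. *)
have [l lN] : exists2 l, l \in N & l \notin [set i; j; k].
  by apply: exists_avoiding; rewrite setUC cardsU1 cards2; do 2!case: (~~ _).
rewrite !inE !negb_or => /andP[/andP[li lj] lk].
have ik : i != k by rewrite eq_sym.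
have neqE := (negbTE ij, negbTE ik, negbTE jk, negbTE li, negbTE lj, negbTE lk).
have neqVE := (eq_sym j i, eq_sym k i, eq_sym k j, eq_sym i l, eq_sym j l, eq_sym k l).
apply: (not_shattered3 ij ik jk) => -[] [] [].
- by exists A.
all: [> exists [set i; j] | exists [set i; k] | exists [set i]
      | exists [set j; k] | exists [set j] | exists [set k] | exists [set l]].
all: first [exact: FN | exact: singleton_mem | by split; rewrite !inE ?eqxx ?orbT ?neqVE ?neqE].
Qed.

(** * Vertices of least size disjoint from [N] *)

Section Minimal.
Variable B : {set T}.
Hypothesis BF : B \in F.
Hypothesis BN : B :&: N = set0.
Hypothesis Bmin : forall A, A \in F -> A :&: N = set0 -> #|B| <= #|A|.

Lemma minimal_notin b : b \in B -> b \notin N.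
Proof.
by move=> bB; apply/negP => bN; have := in_set0 b; rewrite -BN inE bB bN.
Qed.

Lemma proper_notin (P : {set T}) : P \proper B -> P \notin F.
Proof.
move=> PB; apply/negP => /Bmin le; have := proper_card PB; rewrite ltnNge le //.
by apply/eqP; rewrite -subset0 -BN setSI // proper_sub.
Qed.

Lemma notin_minimal i : i \in N -> i \notin B.
Proof. by apply: contraL; apply: minimal_notin. Qed.

(** A first step from [B] toward [[set i]] that deletes an element would contradict minimality, so
    it adds [i]. *)
Lemma add_vertex i : i \in N -> i |: B \in F.
Proof.
move=> iN; have iB := notin_minimal iN.
have BneI : B != [set i] by apply: contraNneq iB => ->; rewrite inE.
have [[t [tB _ Bt]]|[t [_ + tF]]] := Fgeo BF (singleton_mem iN) BneI.
  by have := proper_notin (properD1 tB); rewrite Bt.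
by rewrite inE => /eqP <-.
Qed.

(** A first step from [[set i]] toward [B] cannot drop [i], as [set0] is not a vertex; so it adds an
    element of [B]. *)
Lemma last_vertex i : i \in N -> exists2 b, b \in B & [set i; b] \in F.
Proof.
move=> iN; have iB := notin_minimal iN.
have IneB : [set i] != B by apply: contraNneq iB => <-; rewrite inE.
have [[t []]|[t [_ tB tF]]] := Fgeo (singleton_mem iN) BF IneB.
  rewrite inE => /eqP -> _; rewrite setDv => f0.
  by move: F0; rewrite f0.
by exists t => //; rewrite setUC.
Qed.

(** From [i |: B] toward [[set i]] nothing can be added, and only elements of [B] can be deleted. *)
Lemma first_vertex i : i \in N ->
  exists2 x, x \in B & i |: (B :\ x) \in F.
Proof.
move=> iN; have iB := notin_minimal iN.
have ne : i |: B != [set i].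
  apply: contraNneq F0 => /setP e; suff <- : B = set0 by [].
  apply/setP => t; rewrite inE; apply/negbTE; apply: contraNN iB => tB.
  by have := e t; rewrite !inE tB orbT => /esym/eqP <-.
have [[t []]|[t []]] := Fgeo (add_vertex iN) (singleton_mem iN) ne.
  rewrite !inE => /orP[/eqP -> /negP|tB ti tF]; first by rewrite eqxx.
  exists t => //; suff -> : i |: (B :\ t) = (i |: B) :\ t by [].
  apply/setP => s; rewrite !inE; have [->|//] := eqVneq s i.
  by rewrite eq_sym ti.
by move=> /[swap]; rewrite !inE => ->.
Qed.

(** Otherwise [i], [j], [b] realize all patterns: those with [b] come from [A], [i |: B], [j |: B]
    and [B], those without [b] from subsets of [N]. *)
Lemma pair_notin i j (A : {set T}) b : i \in N -> j \in N -> i != j ->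
  b \in B -> i \in A -> j \in A -> b \in A -> A \notin F.
Proof.
move=> iN jN ij bB iA jA bA; apply/negP => AF.
have iB := notin_minimal iN; have jB := notin_minimal jN.
have ib : i != b by apply: contraNneq iB => ->.
have jb : j != b by apply: contraNneq jB => ->.
have [l lN] : exists2 l, l \in N & l \notin [set i; j].
  by apply: exists_avoiding; rewrite cards2; case: (_ != _).
rewrite !inE negb_or => /andP[li lj].
have lb : l != b by apply: contraTneq lN => ->; apply: minimal_notin.
have neqE := (negbTE ij, negbTE ib, negbTE jb, negbTE li, negbTE lj, negbTE lb).
have neqVE := (eq_sym j i, eq_sym b i, eq_sym b j, eq_sym i l, eq_sym j l, eq_sym b l).
apply: (not_shattered3 ij ib jb) => -[] [] [].
- by exists A.
all: [> exists [set i; j] | exists (i |: B) | exists [set i]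
      | exists (j |: B) | exists [set j] | exists B | exists [set l]].
all: first [exact: FN | exact: singleton_mem | exact: add_vertex | exact: BF
           | by split; rewrite ?inE ?eqxx ?bB ?(negbTE iB) ?(negbTE jB) ?orbT ?neqVE ?neqE].
Qed.

(* A geodesic from [set j; b] to i |: P can neither drop j, by minimality of B,
   nor acquire i before dropping j. *)
Lemma no_geodesic i j b (P : {set T}) : i \in N -> j \in N -> i != j ->
  P \proper B -> i |: P \in F -> b \in P -> [set j; b] \notin F.
Proof.
move=> iN jN ij PB iPF bP; apply/negP => jbF.
have jB := notin_minimal jN; have iB := notin_minimal iN.
have sPB := proper_sub PB.
have iP : i \notin P by apply: contra iB; apply: subsetP.
have jP : j \notin P by apply: contra jB; apply: subsetP.
(* Instead of following a whole geodesic, take a maximal [X] such that [j |: X] is a vertex, and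
   examine a single step from it toward [i |: P]. *)
pose Q (X : {set T}) := [&& b \in X, X \subset P & j |: X \in F].
have Qb : Q [set b] by rewrite /Q inE eqxx sub1set bP.
have [X /maxsetP[/and3P[bX XP XF] Xmax] _] := maxset_exists Qb.
have jX : j \notin X by apply: contra jP; apply: subsetP.
have ne : j |: X != i |: P.
  apply: contraNneq jP => /setP/(_ j); rewrite !inE eqxx /= eq_sym (negbTE ij).
  by rewrite orFb => <-.
have [[t []]|[t []]] := Fgeo XF iPF ne.
  (* Deleting [j] would leave [X], a proper subset of [B]; elements of [X] lie in [P] and are not
     deleted. *)
  rewrite !inE => /orP[/eqP -> _|tX].
    rewrite setU1K // => XF'.
    by have := proper_notin (sub_proper_trans XP PB); rewrite XF'.
  by rewrite (subsetP XP _ tX) orbT.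
(* An added element is [i], excluded by [pair_notin], or lies in [P], against maximality of [X]. *)
rewrite !inE negb_or => /andP[tj tX] /orP[/eqP -> tF|tP].
  have := pair_notin iN jN ij (subsetP sPB _ bP) _ _ _.
  by move=> /(_ (i |: (j |: X))); rewrite !inE !eqxx bX !orbT tF => /(_ isT isT isT).
rewrite setUCA => tF.
have QtX : Q (t |: X) by rewrite /Q !inE bX orbT tF subUset sub1set tP XP.
have := Xmax _ QtX (subsetUr _ _) => e.
by move: tX; rewrite -e !inE eqxx.
Qed.

Lemma minimal_card1 : exists2 b, B = [set b] & forall i, i \in N -> [set i; b] \in F.
Proof.
have [i iN _] : exists2 i, i \in N & i \notin (set0 : {set T}).
  by apply: exists_avoiding; rewrite cards0.
have [j jN] : exists2 j, j \in N & j \notin [set i].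
  by apply: exists_avoiding; rewrite cards1.
rewrite inE => ji.
have [k kN] : exists2 k, k \in N & k \notin [set i; j].
  by apply: exists_avoiding; rewrite cards2; case: (_ != _).
rewrite !inE negb_or => /andP[ki kj].
have [b bB ibF] := last_vertex iN; have [c cB jcF] := last_vertex jN.
have [Bb|neBb] := eqVneq B [set b].
  by exists b => // l lN; rewrite setUC -Bb setUC add_vertex.
have sbB : [set b] \proper B by rewrite properEneq eq_sym neBb sub1set.
(* Here [no_geodesic] is used with [P = [set b]]. *)
have bc : b != c.
  apply: contraTneq jcF => <-; apply: (no_geodesic iN jN _ sbB) => //.
    by rewrite eq_sym.
  by rewrite inE.
have [x xB kxF] := first_vertex kN.
(* With [P = B :\ x], the only element of [B] outside [P] is [x], so [b] and [c] would both equal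
   it. *)
have notin_x l d : l \in N -> k != l -> d \in B -> [set l; d] \in F -> d = x.
  move=> lN kl dB; apply: contraTeq => dx.
  by apply: (no_geodesic kN lN kl (properD1 xB) kxF); rewrite !inE dx.
by rewrite (notin_x _ _ iN ki bB ibF) (notin_x _ _ jN kj cB jcF) eqxx in bc.
Qed.

End Minimal.

(** The first alternative supplies gates, the second a further coordinate for a larger full
    subdivision. *)
Lemma trace_or_extension :
  (forall A, A \in F -> exists i j, [/\ i \in N, j \in N & A :&: N = [set i; j]]) \/
  (exists b, [/\ b \notin N, [set b] \in F & forall i, i \in N -> [set i; b] \in F]).
Proof.
pose untraced (A : {set T}) := (A \in F) && (A :&: N == set0).
case: (pickP untraced) => [A0 A0P|none].
  right; case: (@arg_minnP _ A0 untraced (fun A : {set T} => #|A|) A0P) => B /andP[BF /eqP BN] Bm.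
  have Bmin A : A \in F -> A :&: N = set0 -> #|B| <= #|A|.
    by move=> AF AN; apply: Bm; apply/andP; rewrite AN.
  have [b Bb bF] := minimal_card1 BF BN Bmin.
  exists b; split=> //; last by rewrite -Bb.
  by apply: (minimal_notin BN); rewrite Bb inE.
left=> A AF; have := none A; rewrite /untraced AF /= => /negbT A0.
have := card_trace_le2 AF; rewrite leq_eqVlt => /orP[/cards2P[i [j [ij e]]]|].
  have /setIP[_ iN] : i \in A :&: N by rewrite e !inE eqxx.
  have /setIP[_ jN] : j \in A :&: N by rewrite e !inE eqxx orbT.
  by exists i, j.
rewrite ltnS leq_eqVlt ltnS leqn0 cards_eq0 (negbTE A0) orbF => /cards1P[i e].
have : i \in A :&: N by rewrite e inE.
by rewrite inE => /andP[_ iN]; exists i, i; rewrite setUid.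
Qed.

End TraceOrExtension.

(** * Families in the hypercube given by an isometric embedding *)

Section Embedding.
Variables (G : sgraph) (m : nat) (f : G -> {set 'I_m}).
Hypothesis Gconn : connected G.
Hypothesis fdist : forall x y, dist x y = #|symdiff (f x) (f y)|.

Lemma emb_inj : injective f.
Proof.
move=> x y e; apply/eqP; rewrite -dist_eq0 // fdist e symdiffxx cards0 //.
Qed.

Lemma emb_adj x y : adj x y = (#|symdiff (f x) (f y)| == 1).
Proof. by rewrite -fdist dist_eq1. Qed.

(** The first edge of a geodesic toggles one coordinate, and the drop in distance forces the
    endpoints to differ there. *)
Lemma emb_geodesically_closed : geodesically_closed (f @: [set: G]).
Proof.
move=> _ _ /imsetP[x _ ->] /imsetP[y _ ->]; rewrite (inj_eq emb_inj) => nxy.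
have [z] := dist_step Gconn nxy; rewrite emb_adj => /cards1P[t xz].
have fz : f z = symdiff (f x) [set t] by rewrite -xz symdiffK.
have zy : symdiff (f z) (f y) = symdiff (symdiff (f x) (f y)) [set t].
  by rewrite fz -!symdiffA (symdiffC [set t]).
rewrite !fdist zy card_symdiff1 in_symdiff.
case: ifP => [txy _|_ e]; last by have := ltnn #|symdiff (f x) (f y)|; rewrite {2}e ltnS leqnSn.
have zF : f z \in f @: [set: G] by rewrite imset_f.
move: txy; case tx: (t \in f x); case ty: (t \in f y) => //= _.
  left; exists t; rewrite ty; split=> //; suff <- : f z = f x :\ t by []; rewrite fz.
  by apply/setP => s; rewrite in_symdiff !inE; case: eqP => [->|_]; rewrite ?tx ?addbF.
right; exists t; rewrite tx; split=> //; suff <- : f z = t |: f x by []; rewrite fz.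
by apply/setP => s; rewrite in_symdiff !inE; case: eqP => [->|_]; rewrite ?tx ?addbF.
Qed.

(** Since [i = j] is allowed, singletons occur as well: they are the original vertices of the
    subdivided complete graph on [N], and the two-element sets are the subdividing ones. *)
Definition pairs_of (N : {set 'I_m}) : {set G} :=
  [set x | [exists i in N, exists j in N, f x == [set i; j]]].

Lemma pairs_ofP (N : {set 'I_m}) x :
  reflect (exists i j, [/\ i \in N, j \in N & f x = [set i; j]])
          (x \in pairs_of N).
Proof.
rewrite inE; apply: (iffP exists_inP) => [[i iN /exists_inP[j jN /eqP e]]|].
  by exists i, j.
by case=> i [j [iN jN e]]; exists i => //; apply/exists_inP; exists j; rewrite ?e.
Qed.

(** The sets of [x] and [x'] differ only outside [N], those of [x'] and [y] only inside [N], so the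
    two distances add up. *)
Lemma pairs_of_gate N x x' y : f x' = f x :&: N -> y \in pairs_of N ->
  dist x y = dist x x' + dist x' y.
Proof.
move=> fx' /pairs_ofP[i [j [iN jN fy]]].
have yN : f y \subset N by rewrite fy subUset !sub1set iN.
have x'N : f x' \subset N by rewrite fx' subsetIr.
rewrite !fdist -cardsUI.
have -> : symdiff (f x) (f x') :&: symdiff (f x') (f y) = set0.
  apply/setP => t; rewrite /symdiff fx' !inE.
  have := subsetP yN t; case: (t \in f x); case: (t \in N); case: (t \in f y) => //=.
  by move/(_ isT).
rewrite cards0 addn0; congr #|pred_of_set _|.
apply/setP => t; rewrite /symdiff fx' !inE.
have := subsetP yN t; case: (t \in f x); case: (t \in N); case: (t \in f y) => //=.
by move/(_ isT).
Qed.

Section FullSubdivision.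
Variable N : {set 'I_m}.
Hypothesis FN : {in N &, forall i j, [set i; j] \in f @: [set: G]}.

Let H := pairs_of N.

Lemma pairs_of_vertex i j : i \in N -> j \in N ->
  exists x : induced H, f (val x) = [set i; j].
Proof.
move=> iN jN; have /imsetP[x _ e] := FN iN jN.
have xH : x \in H by apply/pairs_ofP; exists i, j.
by exists (exist _ x xH).
Qed.

Lemma pairs_of_step (x y : induced H) : x != y ->
  exists2 z, adj x z &
    #|symdiff (f (val x)) (f (val y))| = #|symdiff (f (val z)) (f (val y))|.+1.
Proof.
move=> xy.
suff [t [z txy fz]] : exists t, exists2 z : induced H,
    t \in symdiff (f (val x)) (f (val y)) & f (val z) = symdiff (f (val x)) [set t].
  exists z; first by rewrite /= /induced_adj emb_adj fz symdiffK cards1.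
  rewrite fz -symdiffA (symdiffC [set t]) symdiffA card_symdiff1 txy prednK //.
  by rewrite card_gt0; apply/set0Pn; exists t.
have [i [j [iN jN fx]]] := pairs_ofP _ _ (valP x).
have [k [l [kN lN fy]]] := pairs_ofP _ _ (valP y).
have nfxy : f (val x) != f (val y) by rewrite (inj_eq emb_inj).
(* From a singleton, add an element of the target; from a pair, remove an element that the target
   lacks. *)
have [eij|nij] := eqVneq i j.
  have [t [tN ti ty]] : exists t, [/\ t \in N, t != i & t \in f (val y)].
    have [eki|nki] := eqVneq k i; last by exists k; rewrite fy !inE eqxx.
    exists l; rewrite fy !inE eqxx orbT; split=> //.
    by apply: contraNneq nfxy => eli; rewrite fx fy -eij eki eli.
  have [z fz] := pairs_of_vertex iN tN; exists t, z.
    by rewrite in_symdiff ty fx -eij setUid inE (negbTE ti).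
  rewrite fz fx -eij setUid; apply/setP => s; rewrite in_symdiff !inE.
  by have [->|] := eqVneq s i; rewrite ?orbF //= eq_sym (negbTE ti).
have [t [t' [tN t'N ntt' fxt ty]]] : exists t t', [/\ t \in N, t' \in N, t != t',
    f (val x) = [set t; t'] & t \notin f (val y)].
  have [iy|niy] := boolP (i \in f (val y)); last by exists i, j.
  exists j, i; rewrite eq_sym setUC; split=> //.
  apply: contraNN nfxy => jy; rewrite eqEcard fx subUset !sub1set iy jy /=.
  by rewrite fy !cards2 nij; case: (_ != _).
have [z fz] := pairs_of_vertex t'N t'N; exists t, z.
  by rewrite in_symdiff fxt (negbTE ty) !inE eqxx.
rewrite fz fxt setUid; apply/setP => s; rewrite in_symdiff !inE.
have [->|] := eqVneq s t; last by rewrite addbF.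
by rewrite (negbTE ntt').
Qed.

Lemma pairs_of_isometric : isometric_subgraph H.
Proof.
pose D (x y : induced H) := #|symdiff (f (val x)) (f (val y))|.
have Dxx x : D x x = 0 by rewrite /D symdiffxx cards0.
have Dstep : forall x y, x != y -> exists2 z, adj x z & D x y = (D z y).+1.
  exact: pairs_of_step.
split; first exact: connected_of_step Dxx Dstep.
move=> x y; rewrite fdist; apply/esym; apply: (dist_of_step _ Dxx Dstep) => {}x {}y z.
rewrite /= /induced_adj -dist_eq1 // => /eqP xy1; rewrite /D -!fdist -add1n -xy1.
exact: dist_triangle.
Qed.

Lemma pairs_of_isomorphic : isomorphic (induced H) (SK #|N|).
Proof.
pose c (i : 'I_#|N|) : 'I_m := enum_val i.
have cN i : c i \in N := enum_valP i.
have c_inj : injective c := enum_val_inj.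
have code_ex (u : SK #|N|) : exists x : induced H, f (val x) ==
    match u with inl i => [set c i] | inr A => c @: val A end.
  case: u => [i|[A] /=].
    have [x fx] := pairs_of_vertex (cN i) (cN i).
    by exists x; rewrite fx setUid.
  rewrite inE => /existsP[i /existsP[j /andP[_ /eqP ->]]].
  have [x fx] := pairs_of_vertex (cN i) (cN j).
  by exists x; rewrite fx imsetU1 imset_set1.
pose g u := xchoose (code_ex u).
have fg u : f (val (g u)) = match u with inl i => [set c i] | inr A => c @: val A end.
  exact/eqP/(xchooseP (code_ex u)).
have edge2 (A : {A : {set complete #|N|} | A \in edges _}) :
    exists i j, i != j /\ val A = [set i; j].
  by have := valP A; rewrite inE => /existsP[i /existsP[j /andP[ij /eqP ->]]];
     exists i, j.
have cardA (A : {A : {set complete #|N|} | A \in edges _}) : #|c @: val A| = 2.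
  by have [i [j [ij ->]]] := edge2 A; rewrite card_imset // cards2 ij.
have g_inj : injective g.
  move=> u v e; have := fg u; rewrite e fg; case: u {e} => [i|A]; case: v => [j|B].
  - by move/set1_inj/c_inj ->.
  - by move/(congr1 (fun X : {set _} => #|X|)); rewrite cards1 cardA.
  - by move/(congr1 (fun X : {set _} => #|X|)); rewrite cards1 cardA.
  - by move/(imset_inj c_inj)/val_inj ->.
have g_surj x : exists u, g u = x.
  have [i [j [iN jN fx]]] := pairs_ofP _ _ (valP x).
  have [i' _ ei] : exists2 i', true & c i' = i.
    by exists (enum_rank_in iN i); rewrite // /c enum_rankK_in.
  have [j' _ ej] : exists2 j', true & c j' = j.
    by exists (enum_rank_in iN j); rewrite // /c enum_rankK_in.
  have [eij|nij] := eqVneq i' j'.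
    by exists (inl i'); apply/val_inj/emb_inj; rewrite fg fx -ei -ej -eij setUid.
  have ijE : [set i'; j'] \in edges (complete #|N|).
    by rewrite inE; apply/existsP; exists i'; apply/existsP; exists j';
       rewrite eqxx andbT.
  exists (inr (exist _ [set i'; j'] ijE)); apply/val_inj/emb_inj.
  by rewrite fg fx /= imsetU1 imset_set1 ei ej.
have [h hK gK] : bijective g.
  apply: (inj_card_bij g_inj); rewrite -(card_codom g_inj) -cardsT.
  by apply: subset_leq_card; apply/subsetP => x _; have [u <-] := g_surj x; apply: codom_f.
exists h; first by exists g.
move=> x y; rewrite -{2}(gK x) -{2}(gK y); move: (h x) (h y) => {x y} u v.
rewrite /= /induced_adj emb_adj !fg /=.
have adjE i (A : {A : {set complete #|N|} | A \in edges _}) :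
    (#|symdiff (c @: val A) [set c i]| == 1) = (i \in val A).
  by rewrite card_symdiff1 cardA mem_imset //; case: ifP.
case: u => [i|A]; case: v => [j|B].
- by rewrite card_symdiff1 cards1; case: ifP.
- by rewrite symdiffC adjE.
- by rewrite adjE.
(* Toggling two coordinates of a two-element set leaves an even size, so subdividing vertices are
   never adjacent. *)
- have [i [j [ij eB]]] := edge2 B.
  have -> : symdiff (c @: val A) (c @: val B) =
    symdiff (symdiff (c @: val A) [set c i]) [set c j].
    rewrite eB imsetU1 imset_set1 -symdiffA; congr symdiff.
    apply/setP => s; rewrite in_symdiff !inE; have [->|] := eqVneq s (c i) => //=.
    by rewrite (inj_eq c_inj) (negbTE ij).
  by rewrite !card_symdiff1 cardA; do 2!case: ifP.
Qed.

Lemma pairs_of_full_subdivision : full_subdivision H.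
Proof.
by split; [exact: pairs_of_isometric | exists #|N|; exact: pairs_of_isomorphic].
Qed.

End FullSubdivision.
End Embedding.

(** Translation by [o] only permutes the eight patterns, by exclusive or with the pattern of [o]. *)
Lemma realizes_patterns_translate (T : finType) (F : {set {set T}}) (o : {set T}) i j b :
  realizes_patterns [set symdiff o A | A in F] i j b -> realizes_patterns F i j b.
Proof.
move=> all_patterns p q r.
have [_ /imsetP[A AF ->]] :=
  all_patterns ((i \in o) (+) p) ((j \in o) (+) q) ((b \in o) (+) r).
by rewrite !in_symdiff => -[/addbI ip /addbI jq /addbI br]; exists A.
Qed.

(** * Coordinates of a subdivided complete graph *)

(** The isomorphism with [SK n] restated through adjacency in [G]: a subdividing vertex is
    recognized by which [V k] are its neighbours. *)
Definition SK_frame (G : sgraph) (H : {set G}) n (V : 'I_n -> G) : Prop :=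
  [/\ injective V, forall i, V i \in H, forall i j, ~~ adj (V i) (V j),
      forall i j, i != j ->
        exists2 w, w \in H & forall k, adj (V k) w = (k \in [set i; j])
    & forall x, x \in H -> (exists i, x = V i) \/
        exists i j, i != j /\ forall k, adj (V k) x = (k \in [set i; j])].

Lemma SK_frame_exists (G : sgraph) (H : {set G}) n :
  isomorphic (induced H) (SK n) -> exists V : 'I_n -> G, SK_frame H V.
Proof.
case=> h [g hK gK] hadj.
have gadj u v : adj (val (g u)) (val (g v)) = adj u v.
  by rewrite -{2}(gK u) -{2}(gK v) hadj.
exists (fun i => val (g (inl i))); split.
- by move=> i j /val_inj /(can_inj gK) [].
- by move=> i; apply: valP.
- by move=> i j; rewrite gadj.
- move=> i j ij; have ijE : [set i; j] \in edges (complete n).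
    by rewrite inE; apply/existsP; exists i; apply/existsP; exists j; rewrite eqxx andbT.
  exists (val (g (inr (exist _ [set i; j] ijE)))); first exact: valP.
  by move=> k; rewrite gadj.
move=> x xH; have := hK (exist _ x xH); case: (h _) => [i|A] /(congr1 val) /= gx.
  by left; exists i.
have := valP A; rewrite inE => /existsP[i /existsP[j /andP[ij /eqP eA]]].
by right; exists i, j; split=> // k; rewrite -gx gadj -eA.
Qed.

Lemma ord_avoiding n (i j : 'I_n) : 2 < n -> exists2 k, k != i & k != j.
Proof.
move=> n2; have /set0Pn[k] : ~: [set i; j] != set0.
  rewrite -card_gt0 cardsCs setCK cards2 card_ord subn_gt0.
  by apply: leq_ltn_trans n2; case: (_ != _).
by rewrite !inE negb_or => /andP[]; exists k.
Qed.

(* If vertex i is [set i] and the middle of ij is [set i; j], the center is the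
   empty set, the symmetric difference of vertices 0, 1 and their middle. *)
Lemma SK_frame_center (G : sgraph) m (f : G -> {set 'I_m}) (H : {set G}) n
    (V : 'I_n -> G) :
  connected G -> (forall x y, dist x y = #|symdiff (f x) (f y)|) ->
  2 < n -> SK_frame H V ->
  exists (o : {set 'I_m}) (c : 'I_n -> 'I_m), [/\ injective c,
    forall i, symdiff o (f (V i)) = [set c i]
  & forall w i j, i != j -> (forall k, adj (V k) w = (k \in [set i; j])) ->
      symdiff o (f w) = [set c i; c j]].
Proof.
move=> Gconn fdist n2 [V_inj _ _ Wex _].
have f_inj := emb_inj Gconn fdist; have fadj := emb_adj Gconn fdist.
pose i0 : 'I_n := Ordinal (ltn_trans (isT : 0 < 2) n2).
pose i1 : 'I_n := Ordinal (ltn_trans (isT : 1 < 2) n2).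
have [w _ wP] := Wex i0 i1 isT.
(* Both ends differ from their middle in one coordinate, and these coordinates are distinct since
   [V] and [f] are injective. *)
have VV2 i j : i != j -> #|symdiff (f (V i)) (f (V j))| = 2.
  move=> ij; have [x _ xP] := Wex _ _ ij.
  have := xP i; have := xP j; rewrite !inE !eqxx orbT !fadj.
  move=> /cards1P[q jq] /cards1P[p ip].
  rewrite -(symdiff_translate (f x)) symdiffC ![symdiff (f x) _]symdiffC ip jq.
  rewrite card_symdiff1 !inE cards1; case: eqP => // pq; case/eqP: ij.
  apply: V_inj; apply: f_inj; apply: (inv_inj (symdiffK (f x))).
  by rewrite ![symdiff (f x) _]symdiffC ip jq pq.
pose o := symdiff (symdiff (f (V i0)) (f (V i1))) (f w).
have := wP i0; have := wP i1; rewrite !inE !fadj.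
rewrite ![symdiff _ (f w)]symdiffC => /cards1P[q wq] /cards1P[p wp].
have oE x : symdiff o x = symdiff (symdiff (symdiff (f w) x) [set p]) [set q].
  by rewrite -wp -wq /o; apply/setP => s; rewrite !in_symdiff; do 4!case: (s \in _).
have centered i : #|symdiff o (f (V i))| == 1.
  have [->|ni0] := eqVneq i i0; first by rewrite oE wp symdiffxx symdiffC symdiff0 cards1.
  have [->|ni1] := eqVneq i i1.
    by rewrite oE wq symdiffC symdiffA symdiffxx symdiffC symdiff0 cards1.
  have: #|symdiff (symdiff (f w) (f (V i))) [set p]| = 2.
    by rewrite -wp symdiff_translate VV2.
  have: #|symdiff (symdiff (f w) (f (V i))) [set q]| = 2.
    by rewrite -wq symdiff_translate VV2.
  have := wP i; rewrite fadj symdiffC !inE (negbTE ni0) (negbTE ni1) oE /=.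
  (* [X] is the difference between [w] and [V i]. Its size is not 1, by non-adjacency, yet toggling
     [p] or [q] gives size 2; so it has three elements, [p] and [q] among them, and removing both
     leaves one. *)
  set X := symdiff _ _; rewrite !card_symdiff1 in_symdiff in_set1 => X1.
  have pq : (q == p) = false.
    apply/eqP => qp; move: (VV2 i0 i1 isT).
    by rewrite -(symdiff_translate (f w)) wp wq qp symdiffxx cards0.
  case: ifP => qX; last by case=> eX; rewrite eX in X1.
  case: ifP => pX; last by move=> _ [eX]; rewrite eX in X1.
  by rewrite pq => -> _.
(* The default [p] is never returned, because the set is a singleton. *)
pose c i := odflt p [pick x in symdiff o (f (V i))].
have cP i : symdiff o (f (V i)) = [set c i].
  have /cards1P[x ox] := centered i; rewrite /c ox.
  case: pickP => [y|/(_ x)]; first by rewrite inE => /eqP ->.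
  by rewrite inE eqxx.
have c_inj : injective c.
  by move=> i j e; apply/V_inj/f_inj/(inv_inj (symdiffK o)); rewrite !cP e.
exists o, c; split=> // x i j ij xP.
(* A set at distance one from [[set c i]] and [[set c j]] is their union or the empty set; the empty
   set is excluded as it would be adjacent to [V k] too. *)
have [k ki kj] := ord_avoiding i j n2.
pose X := symdiff o (f x).
have adjX l : adj (V l) x = (#|symdiff X [set c l]| == 1).
  by rewrite fadj -(symdiff_translate o) cP symdiffC.
have := xP i; have := xP j; have := xP k.
rewrite !inE !eqxx orbT (negbTE ki) (negbTE kj) !adjX !card_symdiff1 -/X.
have [iX|iX] := boolP (c i \in X); have [jX|jX] := boolP (c j \in X).
- move=> _ X1 _; apply/esym/eqP; rewrite eqEcard subUset !sub1set iX jX cards2.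
  by rewrite (inj_eq c_inj) ij; case: #|X| X1 => [|[|[|]]].
- by rewrite eqSS cards_eq0 => _ /eqP X0; rewrite X0 inE in iX.
- by rewrite eqSS cards_eq0 => _ _ /eqP X0; rewrite X0 inE in jX.
rewrite eqSS cards_eq0 => + /eqP X0.
by rewrite X0 inE cards0.
Qed.

(** * Recentring the embedding and choosing the gate *)

Theorem proposition23 (G : sgraph) (m : nat) (f : G -> {set 'I_m})
    (n : nat) (H : {set G})
    (Gconn : connected G)
    (Gcube : @isometric_embedding G (hypercube m) f)
    (Gvc : VCdim (f @: [set: G]) <= 2)
    (n_ge4 : 4 <= n)
    (H_SK : isomorphic (induced H) (SK n))
    (Hconvex : convex_subgraph H)
    (Hmax : ~ exists2 H' : {set G}, full_subdivision H' & H \proper H') :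
  gated_subgraph H.
Proof.
have fdist x y : dist x y = #|symdiff (f x) (f y)| by rewrite -Gcube hypercube_dist.
have n2 : 2 < n by apply: ltn_trans n_ge4.
have [V HV] := SK_frame_exists H_SK; have [_ VH VV Wex Hcase] := HV.
have [o [c [c_inj oV oW]]] := SK_frame_center Gconn fdist n2 HV.
pose f' x := symdiff o (f x).
have f'dist x y : dist x y = #|symdiff (f' x) (f' y)|.
  by rewrite /f' symdiff_translate.
have f'_inj := emb_inj Gconn f'dist.
pose N := c @: [set: 'I_n].
have cN i : c i \in N by apply: imset_f.
have HE : H = pairs_of f' N.
  apply/setP => x; apply/idP/pairs_ofP => [/Hcase[[i ->]|[i [j [ij xP]]]]|].
  - by exists (c i), (c i); rewrite setUid /f' oV.
  - by exists (c i), (c j); rewrite /f' (oW _ _ _ ij xP).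
  case=> _ [_ [/imsetP[i _ ->] /imsetP[j _ ->]]].
  have [<-|ij] := eqVneq i j; first by rewrite setUid -oV => /f'_inj ->.
  by have [w wH wP] := Wex _ _ ij; rewrite -(oW _ _ _ ij wP) => /f'_inj ->.
pose F := f' @: [set: G].
have Fgeo : geodesically_closed F := emb_geodesically_closed Gconn f'dist.
have FN : {in N &, forall i j, [set i; j] \in F}.
  move=> _ _ /imsetP[i _ ->] /imsetP[j _ ->]; have [<-|ij] := eqVneq i j.
    by rewrite setUid -oV; apply: imset_f.
  by have [w wH wP] := Wex _ _ ij; rewrite -(oW _ _ _ ij wP); apply: imset_f.
have Fvc i j b : i != j -> i != b -> j != b -> ~ realizes_patterns F i j b.
  move=> ij ib jb; have := VCdim2_not_realizes Gvc ij ib jb; apply: contra_not.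
  rewrite /F (_ : f' @: _ = [set symdiff o A | A in f @: [set: G]]).
    exact: realizes_patterns_translate.
  by rewrite -imset_comp.
have N4 : 4 <= #|N| by rewrite card_imset // cardsT card_ord.
have F0 : set0 \notin F.
  (* A vertex at the center would be adjacent to every [V i], hence in [H] by convexity; but a
     vertex of [H] misses some [V k]. *)
  apply/imsetP => -[x _ x0].
  have Vx i : adj (V i) x.
    by rewrite (emb_adj Gconn f'dist) -x0 symdiff0 /f' oV cards1.
  pose i0 : 'I_n := Ordinal (ltn_trans (isT : 0 < 2) n2).
  pose i1 : 'I_n := Ordinal (ltn_trans (isT : 1 < 2) n2).
  have sp : shortest_path (V i0) (V i1) [:: x; V i1].
    rewrite /shortest_path /is_walk /= Vx adj_sym Vx eqxx f'dist /f' !oV.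
    by rewrite card_symdiff1 inE (inj_eq c_inj) cards1.
  have xH : x \in H by apply: (Hconvex _ _ _ (VH i0) (VH i1) sp); rewrite mem_head.
  have [[i xi]|[i [j [_ xP]]]] := Hcase _ xH.
    by have := Vx i; rewrite xi adj_irr.
  have [k ki kj] := ord_avoiding i j n2.
  by have := Vx k; rewrite xP !inE (negbTE ki) (negbTE kj).
have [trace|[b [bN bF NbF]]] := trace_or_extension Fgeo Fvc N4 FN F0; last first.
  (* The new coordinate [b] enlarges [H]; the vertex [[set b]] shows that the inclusion is
     proper. *)
  case: Hmax; exists (pairs_of f' (b |: N)).
    apply: pairs_of_full_subdivision => // i j; rewrite !inE.
    move=> /predU1P[->|iN] /predU1P[->|jN].
    - by rewrite setUid.
    - by rewrite setUC NbF.
    - by rewrite NbF.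
    - exact: FN.
  rewrite HE properE; apply/andP; split.
    apply/subsetP => x /pairs_ofP[i [j [iN jN fx]]].
    by apply/pairs_ofP; exists i, j; rewrite !inE iN jN !orbT.
  have /imsetP[x _ bx] := bF.
  apply/subsetPn; exists x; first by apply/pairs_ofP; exists b, b; rewrite setUid !inE eqxx.
  apply/pairs_ofP => -[i [j [iN _ fx]]]; case/negP: bN.
  have : i \in [set b] by rewrite bx fx !inE eqxx.
  by rewrite inE => /eqP <-.
(* The gate of [x] is the vertex whose set is the trace of [f' x] on [N]; geodesics to and from it
   concatenate. *)
move=> x _; have [i [j [iN jN tr]]] := trace _ (imset_f f' (in_setT x)).
have /imsetP[x' _ fx'] := FN _ _ iN jN.
have x'H : x' \in H by rewrite HE; apply/pairs_ofP; exists i, j.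
exists x' => // y yH; rewrite HE in yH.
have gate := pairs_of_gate f'dist (etrans (esym fx') (esym tr)) yH.
have [p /andP[/andP[pp /eqP lp] /eqP sp]] := shortest_path_exists (Gconn x x').
have [q /andP[/andP[pq /eqP lq] /eqP sq]] := shortest_path_exists (Gconn x' y).
exists (p ++ q).
  by rewrite /shortest_path /is_walk cat_path last_cat pp lp pq lq eqxx size_cat sp sq gate eqxx.
by rewrite -cat_cons mem_cat -{1}lp mem_last.
Qed.
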